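(* Let $\varepsilon_1:=\frac14\left(1-\frac{1}{4\sqrt2}\right)$, let $\varepsilon\colon\mathbb{N}\to(0,\infty)$, and let $\mathcal{A}=\{n\in\mathbb{N} : \|\sqrt2\,n^2\|_{\mathbb{R}/\mathbb{Z}}<\varepsilon(n)\}$. Suppose that either there is a constant $\varepsilon_0<\varepsilon_1$ such that $\varepsilon(n)\le\varepsilon_0$ for all $n$, or that $\varepsilon(n)\to0$ as $n\to\infty$. Then $\mathcal{A}$ is not a basis of order $2$. In the case when $\varepsilon(n)\le\varepsilon_0<\varepsilon_1$ for all $n$, we additionally have the quantitative bound $$\bigl|[T]\setminus 2\mathcal{A}\bigr|\ge c\log T\quad\text{for all integers } T\ge2,$$ where $c>0$ is a constant depending at most on $\varepsilon_0,\varepsilon_1$.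
   Context: $\mathbb{N}=\{0,1,2,\dots\}$, $[T]=\{1,\dots,T\}$, and $\|t\|_{\mathbb{R}/\mathbb{Z}}=\min_{n\in\mathbb{Z}}|t-n|$. For $\mathcal{A}\subset\mathbb{N}$, $2\mathcal{A}=\{n_1+n_2 : n_1,n_2\in\mathcal{A}\}$; $\mathcal{A}$ is a basis of order $2$ if $2\mathcal{A}$ contains all sufficiently large integers. *)

(* Defs.v *)
From HB Require Import structures.
From mathcomp Require Import all_boot all_order all_algebra finmap.
From mathcomp Require Import all_classical all_reals all_analysis.
Set Implicit Arguments.
Unset Strict Implicit.
Unset Printing Implicit Defensive.
Import Order.TTheory GRing.Theory Num.Theory.
Import numFieldNormedType.Exports.
Local Open Scope classical_set_scope.
Local Open Scope ring_scope.

Definition dist_int (R : realType) (t : R) : R :=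
  inf [set `|t - n%:~R| | n in [set: int]].

(* The infimum defining [dist_int] is attained, so it is a minimum. *)
Lemma dist_int_min (R : realType) (t : R) :
  (exists n : int, dist_int t = `|t - n%:~R|) /\
  (forall n : int, dist_int t <= `|t - n%:~R|).
Proof.
pose S := [set `|t - n%:~R| | n in [set: int]].
have lbS : lbound S 0 by move=> _ [n _ <-].
have hasS : has_lbound S by exists 0.
have le n : dist_int t <= `|t - n%:~R| by apply: ge_inf => //; exists n.
split=> //.
set f := Num.floor t.
have [f0 f1] : 0 <= t - f%:~R /\ t < f%:~R + 1.
  by rewrite subr_ge0 floor_le -[1]/(1%:~R) -intrD floorD1_gt.
pose m := Num.min `|t - f%:~R| `|t - (f + 1)%:~R|.
suff mle : m <= dist_int t.
  have [e|e] : m = `|t - f%:~R| \/ m = `|t - (f + 1)%:~R|.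
    by rewrite /m; case: leP; [left|right].
  - by exists f; apply/eqP; rewrite eq_le le -e mle.
  - by exists (f + 1); apply/eqP; rewrite eq_le le -e mle.
apply: lb_le_inf; first by exists `|t - 0%:~R|; exists 0.
move=> _ [n _ <-]; rewrite /m ge_min.
case: (leP n f) => nf.
- apply/orP; left; have nf' : n%:~R <= f%:~R :> R by rewrite ler_int.
  rewrite !ger0_norm ?lerD2l ?lerN2 //.
  by apply: le_trans f0 _; rewrite lerD2l lerN2.
- apply/orP; right.
  have nf' : (f + 1)%:~R <= n%:~R :> R by rewrite ler_int lezD1.
  have t1 : t - (f + 1)%:~R <= 0 by rewrite subr_le0 intrD ltW.
  rewrite !ler0_norm ?lerN2 ?lerD2l ?lerN2 //.
  by apply: le_trans t1; rewrite lerD2l lerN2.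
Qed.

Definition eps1 (R : realType) : R := 4^-1 * (1 - (4 * Num.sqrt 2)^-1).

Definition sqrt2_set (R : realType) (eps : nat -> R) : set nat :=
  [set n | dist_int (Num.sqrt 2 * n%:R ^+ 2) < eps n].

Definition twofold_sumset (A : set nat) : set nat :=
  [set (n1 + n2)%N | n1 in A & n2 in A].

Definition basis_of_order2 (A : set nat) : Prop :=
  \forall n \near \oo, twofold_sumset A n.

Definition initial_interval (T : nat) : set nat := [set k | 1 <= k <= T]%N.

(* Main.v *)
(* If $m^2 = 8N^2+1$ with $N$ odd, then $2\sqrt2 N = m+\delta$ with
   $\delta = -1/(m+2\sqrt2 N)$, so for $n_1+n_2=N$ the difference
   $\sqrt2 n_2^2 - \sqrt2 n_1^2 = \sqrt2 N^2 - 2\sqrt2 N n_1$ equals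
   $1/2 + \delta(N/2-n_1)$ modulo 1, hence is at distance more than
   $1/2 - 1/(8\sqrt2) = 2\varepsilon_1$ from the integers. So $n_1$, $n_2$ cannot
   both satisfy $\|\sqrt2 n_i^2\| < \varepsilon_1$. These $N$ grow
   geometrically, which gives the logarithmic bound. If only
   $\varepsilon(n)\to0$, the finitely many small $n_1$ need another argument:
   as $N\to\infty$, $\sqrt2 n_2^2$ tends modulo 1 to
   $\sqrt2 n_1^2 - \sqrt2/16 + 1/2$, which is not an integer. *)
Require Import Defs.
From HB Require Import structures.
From mathcomp Require Import all_boot all_order all_algebra finmap.
From mathcomp Require Import all_classical all_reals all_analysis.
From mathcomp Require Import zify ring lra.
Set Implicit Arguments.
Unset Strict Implicit.
Unset Printing Implicit Defensive.
Import Order.TTheory GRing.Theory Num.Theory.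
Import numFieldNormedType.Exports.
Local Open Scope fset_scope.
Local Open Scope classical_set_scope.
Local Open Scope ring_scope.

Definition odd_pell (m N : nat) : Prop := (m ^ 2 = 8 * N ^ 2 + 1 /\ odd N)%N.

(* Multiplication by the unit $17 + 6\sqrt8 = (3+\sqrt8)^2$ keeps $N$ odd. *)
Fixpoint pell (j : nat) : nat * nat :=
  if j is i.+1 then
    let: (m, N) := pell i in (17 * m + 48 * N, 6 * m + 17 * N)%N
  else (3, 1)%N.

Lemma pellP j : odd_pell (pell j).1 (pell j).2.
Proof.
elim: j => [//|j] /=; case: (pell j) => m N [/= e oN]; split; first by nia.
by rewrite oddD !oddM oN.
Qed.

Lemma pell_ltS j : ((pell j).2 < (pell j.+1).2)%N.
Proof.
have := pellP j; rewrite /=; case: (pell j) => m N [/= e oN].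
by case: N e oN => // N _ _; lia.
Qed.

Lemma pell_geq j : (j < (pell j).2)%N.
Proof. by elim: j => // j ih; apply: leq_ltn_trans ih (pell_ltS j). Qed.

Lemma pell_inj : injective (fun j => (pell j).2).
Proof.
have mono : {homo (fun j => (pell j).2) : i j / (i < j)%N}.
  by apply: homo_ltn; [exact: ltn_trans | exact: pell_ltS].
by move=> i j e; case: (ltngtP i j) => // /mono; rewrite e ltnn.
Qed.

Lemma pell_leq j : ((pell j).2 <= 35 ^ j)%N.
Proof.
elim: j => // j; have := pellP j; rewrite /= expnS.
case: (pell j) => m N [/= e oN] ih.
(* From [m ^ 2 = 8 * N ^ 2 + 1 <= 9 * N ^ 2]; hence the growth factor is at most
   [6 * 3 + 17 = 35]. *)
have : (m <= 3 * N)%N by nia.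
by lia.
Qed.

Lemma sqrt2_sqr (R : realType) : (Num.sqrt 2 : R) ^+ 2 = 2.
Proof. by rewrite sqr_sqrtr. Qed.

Lemma sqrt2_gt0 (R : realType) : (0 : R) < Num.sqrt 2.
Proof. by rewrite sqrtr_gt0. Qed.

(** Rationalised to be linear in [Num.sqrt 2], as [lra] needs. *)
Lemma eps1E (R : realType) : eps1 R = 4^-1 - Num.sqrt 2 / 32.
Proof.
have s2 := sqrt2_sqr R; have s0 := sqrt2_gt0 R.
rewrite /eps1; have -> : (4 * Num.sqrt 2 : R)^-1 = Num.sqrt 2 / 8.
  by apply: (mulfI (lt0r_neq0 s0)); rewrite invfM mulrCA mulfV ?lt0r_neq0//; nra.
by lra.
Qed.

Lemma eps1_gt0 (R : realType) : 0 < eps1 R.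
Proof. by have := sqrt2_sqr R; have := sqrt2_gt0 R; rewrite eps1E; nra. Qed.

Lemma half_le_norm (R : realType) (k : int) : (2^-1 : R) <= `|k%:~R + 2^-1|.
Proof.
have [k0|k0] := leP 0 k.
  have : (0 : R) <= k%:~R by rewrite ler0z.
  by move=> ?; rewrite ger0_norm; lra.
have : (k%:~R : R) <= -1 by rewrite -[-1]/((-1)%:~R) ler_int; lia.
by move=> ?; rewrite ler0_norm; lra.
Qed.

Lemma odd_pell_odd m N : odd_pell m N -> odd m.
Proof.
case=> e _; have : odd (m ^ 2)%N by rewrite e oddD oddM.
by rewrite oddX.
Qed.

(** Here [d] is $-\delta = 1/(m+2\sqrt2 N)$. The upper bound on [d * N] rules out pairs of close
    summands; the lower one gives the limit for fixed [n1]. *)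
Lemma odd_pell_delta (R : realType) (m N : nat) : odd_pell m N ->
  exists d : R, [/\ 2 * Num.sqrt 2 * N%:R = m%:R - d, 0 < d,
    d * N%:R < Num.sqrt 2 / 8 & Num.sqrt 2 / 8 - d * N%:R <= d].
Proof.
case=> e oN; have s2 := sqrt2_sqr R; have s0 := sqrt2_gt0 R.
set s := Num.sqrt 2 in s2 s0 *.
have N1 : (1 : R) <= N%:R by rewrite ler1n; case: N oN {e}.
have m1 : (1 : R) <= m%:R by rewrite ler1n; case: m e => //; lia.
have eR : (m%:R : R) ^+ 2 = 8 * N%:R ^+ 2 + 1.
  by rewrite -!natrX e natrD natrM natrX.
move: (N%:R : R) (m%:R : R) N1 m1 eR => y x y1 x1 exy.
have s1 : 1 < s by nra.
pose d := x - 2 * s * y.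
have dE : d * (x + 2 * s * y) = 1.
  have -> : d * (x + 2 * s * y) = x ^+ 2 - 4 * s ^+ 2 * y ^+ 2 by rewrite /d; ring.
  by rewrite exy s2; ring.
have sy : 1 < s * y by nra.
have d0 : 0 < d by nra.
have d1 : d < 1 by nra.
(* Since [x + 2 * s * y = d + 4 * s * y], [dE] is a quadratic equation in [d]. Both bounds follow
   from [0 < d < 1 < 4 * s]. *)
have key : 4 * s * (s / 8 - d * y) = d ^+ 2.
  have -> : 4 * s * (s / 8 - d * y) = s ^+ 2 / 2 - 4 * s * y * d by field.
  have -> : d ^+ 2 = d * (x + 2 * s * y) - 4 * s * y * d by rewrite /d; ring.
  by rewrite dE s2; field.
by exists d; split=> //; [rewrite /d; ring | nra | nra].
Qed.

Lemma odd_pell_sqrt2 (R : realType) (m n1 n2 : nat) (d : R) :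
    odd_pell m (n1 + n2) ->
    2 * Num.sqrt 2 * (n1 + n2)%:R = m%:R - d ->
  exists k : int, Num.sqrt 2 * n2%:R ^+ 2 =
    Num.sqrt 2 * n1%:R ^+ 2 + k%:~R + 2^-1 - d * ((n1 + n2)%:R / 2 - n1%:R).
Proof.
move=> pN; have [_ oN] := pN; have om := odd_pell_odd pN => dE.
(* The term $mN/2$ of the difference is a half-integer because $m$ and $N$ are odd. *)
have [r rE] : exists r, (m * (n1 + n2))%N = r.*2.+1.
  exists (m * (n1 + n2))./2; rewrite -[LHS]odd_double_half oddM om oN.
  by rewrite add1n.
exists (r%:Z - (m * n1)%:Z).
have {}rE : (m%:R : R) * (n1 + n2)%:R = 2 * r%:R + 1.
  by rewrite -natrM rE -natr1 -muln2 natrM mulrC.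
rewrite intrB -!pmulrn natrM.
move: dE rE; rewrite natrD => dE rE.
have dE' : d = m%:R - 2 * Num.sqrt 2 * (n1%:R + n2%:R) by rewrite dE; ring.
have -> : (r%:R : R) = (m%:R * (n1%:R + n2%:R) - 1) / 2 by rewrite rE; field.
by rewrite dE'; field.
Qed.

Lemma odd_pell_not_both (R : realType) (m n1 n2 : nat) :
  odd_pell m (n1 + n2) ->
  dist_int (Num.sqrt 2 * n1%:R ^+ 2 : R) < eps1 R ->
  dist_int (Num.sqrt 2 * n2%:R ^+ 2 : R) < eps1 R -> False.
Proof.
move=> pN.
have [p ->] := (dist_int_min (Num.sqrt 2 * n1%:R ^+ 2 : R)).1.
have [q ->] := (dist_int_min (Num.sqrt 2 * n2%:R ^+ 2 : R)).1.
have [d [dE d0 dlt _]] := odd_pell_delta R pN.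
have [k kE] := odd_pell_sqrt2 pN dE.
have := half_le_norm R (k + p - q); rewrite intrB intrD eps1E.
have n20 : (0 : R) <= n2%:R by [].
have n10 : (0 : R) <= n1%:R by [].
(* As [n1] lies between 0 and $N$, the second factor is at most $N/2$ in absolute value. The three
   errors then total less than $2\varepsilon_1 + \sqrt2/16 = 1/2$. *)
have dlt' : `|d * ((n1 + n2)%:R / 2 - n1%:R)| < Num.sqrt 2 / 16.
  by rewrite ltr_norml; move: dlt; rewrite natrD => dlt; apply/andP; split; nra.
move: kE dlt'; set e := d * _; set u := _ * n1%:R ^+ 2; set v := _ * n2%:R ^+ 2.
move=> vE; rewrite !ltr_norml => /andP[? ?] h /andP[? ?] /andP[? ?].
by move: h; apply/negP; rewrite -ltNge ltr_norml; apply/andP; split; lra.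
Qed.

(* As $n_2 \to \infty$ with $n_1$ fixed, $\sqrt2 n_2^2$ tends to this
   non-integer modulo 1. *)
Lemma dist_int_limit_gt0 (R : realType) (n : nat) :
  0 < dist_int (Num.sqrt 2 * n%:R ^+ 2 - Num.sqrt 2 / 16 + 2^-1 : R).
Proof.
have [k ->] :=
  (dist_int_min (Num.sqrt 2 * n%:R ^+ 2 - Num.sqrt 2 / 16 + 2^-1 : R)).1.
rewrite normr_gt0; apply/eqP => e.
have s2 := sqrt2_sqr R.
(* Multiplying by 16 gives $b = \sqrt2\,a$. This fails modulo 4 after squaring, since [a] is odd and
   [b] even. *)
pose a := 16 * (n ^ 2)%:Z - 1; pose b := 16 * k - 8.
have bE : b%:~R = Num.sqrt 2 * a%:~R :> R.
  by rewrite !intrB !intrM -pmulrn natrX; lra.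
have : (b * b)%:~R = (2 * (a * a))%:~R :> R.
  rewrite !intrM bE.
  have -> : 2%:~R = Num.sqrt 2 ^+ 2 :> R by rewrite s2.
  by ring.
by move/eqP; rewrite eqr_int => /eqP; rewrite /a /b; nia.
Qed.

(** A quantitative form of the convergence: modulo 1, $\sqrt2 n_2^2$ is within [d * n1.+1] of its
    limit [t], and [d * n2 <= 1]. With [eta] half the distance of [t] to the integers, closeness to
    an integer bounds [n2]. *)
Lemma odd_pell_small (R : realType) (n1 : nat) :
  exists2 eta : R, 0 < eta & forall m n2, odd_pell m (n1 + n2) ->
    dist_int (Num.sqrt 2 * n2%:R ^+ 2 : R) < eta ->
    eta * n2%:R <= n1.+1%:R.
Proof.
set t : R := Num.sqrt 2 * n1%:R ^+ 2 - Num.sqrt 2 / 16 + 2^-1.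
have t0 : 0 < dist_int t := dist_int_limit_gt0 R n1.
exists (dist_int t / 2) => [|m n2 pN]; first by rewrite divr_gt0.
have [q ->] := (dist_int_min (Num.sqrt 2 * n2%:R ^+ 2 : R)).1.
have [d [dE d0 dlt dle]] := odd_pell_delta R pN.
have [k kE] := odd_pell_sqrt2 pN dE => lt_q.
have le_t := (dist_int_min t).2 (q - k).
have s2 := sqrt2_sqr R; have s0 := sqrt2_gt0 R.
have n20 : (0 : R) <= n2%:R by [].
have n10 : (0 : R) <= n1%:R by [].
have dn0 : 0 <= d * n1%:R by nra.
have le_d : dist_int t / 2 <= d * n1.+1%:R.
  move: le_t lt_q; rewrite ler_normr ltr_norml intrB -(natr1 n1) => le_t /andP[? ?].
  have kE' : Num.sqrt 2 * n2%:R ^+ 2 = t + k%:~R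
      + (Num.sqrt 2 / 8 - d * (n1 + n2)%:R) / 2 + d * n1%:R.
    by rewrite kE /t; field.
  by case/orP: le_t => ?; lra.
have dn2 : d * n2%:R <= 1.
  by move: dlt; rewrite natrD; nra.
by rewrite -(natr1 n1) in le_d *; nra.
Qed.

Lemma odd_pell_eventually (R : realType) (eps : nat -> R) (K : nat) :
  eps @ \oo --> (0 : R) ->
  \forall n2 \near \oo, forall n1 m, (n1 < K)%N -> odd_pell m (n1 + n2) ->
    ~ sqrt2_set eps n2.
Proof.
move=> eps0; elim: K => [|K IH]; first by near=> n2 => n1 m.
(* Each [n1] has its own [eta]; the induction on [K] merges finitely many thresholds for [n2]. *)
have [eta eta0 etaP] := odd_pell_small R K.
near=> n2 => n1 m.
rewrite ltnS leq_eqVlt => /predU1P[-> pN|]; last by move: n1 m; near: n2.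
rewrite /sqrt2_set /= => lt_eps.
have lt_eta : eps n2 < eta by near: n2; exact: cvgr_lt eps0 _ eta0.
have := etaP _ _ pN (lt_trans lt_eps lt_eta); apply/negP; rewrite -ltNge.
rewrite mulrC -ltr_pdivrMr//; near: n2; exact: nbhs_infty_gtr.
Unshelve. all: by end_near. Qed.

Lemma pell_notin_sumset (R : realType) (eps : nat -> R) j :
  (forall n, eps n <= eps1 R) -> ~ twofold_sumset (sqrt2_set eps) (pell j).2.
Proof.
move=> le_eps [n1 A1 [n2 A2 e]]; have pN := pellP j; rewrite -e in pN.
apply: (odd_pell_not_both pN).
  exact: lt_le_trans A1 (le_eps _).
exact: lt_le_trans A2 (le_eps _).
Qed.

Lemma basis_of_order2_pell (A : set nat) (K : nat) : basis_of_order2 A ->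
  exists j, (K <= (pell j).2)%N /\ twofold_sumset A (pell j).2.
Proof.
case=> M _ MP; exists (maxn K M); have := pell_geq (maxn K M) => lt_j.
split; first by lia.
by apply: MP => /=; lia.
Qed.

Lemma pell_card (R : realType) (A : set nat) (T : nat) :
  (2 <= T)%N -> (forall j, ~ A (pell j).2) ->
  (ln 35)^-1 * ln (T%:R : R) <= #|` fset_set (initial_interval T `\` A)|%:R.
Proof.
move=> T2 AP; set k := trunc_log 35 T.
have /andP[le_T lt_T] : (35 ^ k <= T < 35 ^ k.+1)%N.
  by apply: trunc_log_bounds => //; lia.
have finT : finite_set (initial_interval T `\` A).
  apply: finite_setD; apply: (sub_finite_set _ (finite_II T.+1)) => i /=.
  by case/andP.
(* The indices 0 to [k] give distinct missing elements, all at most [35 ^ k <= T]. *)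
have le_k : (k.+1 <= #|` fset_set (initial_interval T `\` A)|)%N.
  rewrite -[k.+1](size_iota 0) -(size_map (fun j => (pell j).2)).
  apply: uniq_leq_size; first by rewrite (map_inj_uniq pell_inj) iota_uniq.
  move=> i /mapP[j]; rewrite mem_iota add0n ltnS => /andP[_ lejk] ->{i}.
  rewrite in_fset_set// inE; split; last exact: AP.
  have := pell_geq j; have := pell_leq j.
  have : (35 ^ j <= 35 ^ k)%N by rewrite leq_exp2l.
  by rewrite /initial_interval /=; lia.
have ln35 : (0 : R) < ln 35 by rewrite ln_gt0 // ltr1n.
apply: (@le_trans _ _ (k.+1%:R)); last by rewrite ler_nat.
rewrite mulrC ler_pdivrMr // mulr_natl -lnXn // ler_ln ?posrE ?exprn_gt0 ?ltr0n //.
  by rewrite -natrX ler_nat ltnW.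
by lia.
Qed.

Theorem proposition1p3 (R : realType) :
  (forall eps : nat -> R, (forall n, 0 < eps n) ->
     (exists2 eps0 : R, eps0 < eps1 R & forall n, eps n <= eps0) \/
     (eps @ \oo --> (0 : R)) ->
     ~ basis_of_order2 (sqrt2_set eps)) /\
  (forall eps0 : R, eps0 < eps1 R ->
     exists2 c : R, 0 < c &
       forall eps : nat -> R,
         (forall n, 0 < eps n) -> (forall n, eps n <= eps0) ->
         forall T : nat, (2 <= T)%N ->
           c * ln (T%:R : R) <=
             #|` fset_set (initial_interval T `\`
                             twofold_sumset (sqrt2_set eps))|%:R).
Proof.
split=> [eps _ [[eps0 lt_eps0 le_eps]|eps0] basis|eps0 lt_eps0].
- have [j [_ ]] := basis_of_order2_pell 0 basis.
  by apply: pell_notin_sumset => n; apply: le_trans (le_eps n) (ltW lt_eps0).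
- have [K _ KP] := cvgr_lt _ eps0 _ (eps1_gt0 R).
  have [M _ MP] := odd_pell_eventually K eps0.
  (* Beyond [K], [eps] is below [eps1]. A sum of at least [K + M] forces the other summand past [M]
     as soon as one is below [K]. *)
  have [j [le_j [n1 A1 [n2 A2 e]]]] := basis_of_order2_pell (K + M) basis.
  have := pellP j; rewrite -e => pN; rewrite -{}e in le_j.
  case: (ltnP n1 K) => n1K.
    by apply: (MP n2 _ _ _ n1K pN) => //=; lia.
  case: (ltnP n2 K) => n2K.
    by rewrite addnC in pN; apply: (MP n1 _ _ _ n2K pN) => //=; lia.
  apply: (odd_pell_not_both pN); first exact: lt_trans A1 (KP _ n1K).
  exact: lt_trans A2 (KP _ n2K).
- exists (ln 35)^-1; first by rewrite invr_gt0 ln_gt0 // ltr1n.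
  move=> eps _ le_eps T T2; apply: pell_card => // j.
  by apply: pell_notin_sumset => n; apply: le_trans (le_eps n) (ltW lt_eps0).
Qed.
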